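(* Let $H$ be a Hilbert space and $\mathcal A=B(H)$. Let $E\subseteq l^2(\mathcal A)$ be a bounded $\mathcal A$-balanced set. Then $$\lambda(E)\le\sqrt{\|E\|\,I^*(E)},$$ where $\|E\|=\sup_{x\in E}\|x\|$.
   Context: $B(H)$ is the algebra of all bounded operators on $H$. $l^2(\mathcal A)$ is the standard Hilbert module: the right $\mathcal A$-module of all sequences $x=(\xi_1,\xi_2,\dots)$ in $\mathcal A$ for which $\sum_{j}\xi_j^*\xi_j$ converges in norm, with $\mathcal A$-valued inner product $\langle x,y\rangle=\sum_j\xi_j^*\eta_j$ (for $y=(\eta_1,\eta_2,\dots)$), norm $\|x\|=\|\langle x,x\rangle\|^{1/2}$ and module action $(\xi_1,\xi_2,\dots)a=(\xi_1a,\xi_2a,\dots)$. A bounded set $E\subseteq l^2(\mathcal A)$ is $\mathcal A$-balanced if $xu\in E$ whenever $x\in E$ and $u\in\mathcal A$ is unitary. A free finitely generated submodule $M\le l^2(\mathcal A)$ is a closed $\mathcal A$-submodule isomorphic, as a Hilbert $\mathcal A$-module, to $\mathcal A^n$ for some $n\in\mathbb N$. For a bounded set $E$, $\lambda(E)$ is the greatest lower bound of all $\eta>0$ for which there is a free finitely generated submodule $M\le l^2(\mathcal A)$ with $\sup_{x\in E}\inf_{y\in M}\|x-y\|<\eta$. Let $P$ be the set of all semi-norms $p_{\varphi,y}(x)=\sqrt{\sum_{j=1}^\infty|\varphi(\eta_j^*\xi_j)|^2}$, $x=(\xi_1,\xi_2,\dots)\in l^2(\mathcal A)$, where $\varphi\in\mathcal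 A_*$ is a normal state and $y=(\eta_1,\eta_2,\dots)$ is a sequence of elements of $\mathcal A$ with $\sup_{j\ge1}\varphi(\eta_j^*\eta_j)=1$. For $p\in P$, $[I(E)](p)$ is the supremum of all $\varepsilon>0$ for which there is an infinite set $S\subseteq E$ with $p(x'-x'')\ge\varepsilon$ for all distinct $x',x''\in S$ (and $0$ if there is no such $\varepsilon$), and $I^*(E)=\sup_{p\in P}[I(E)](p)$. *)

(* Defs.v *)
From HB Require Import structures.
From mathcomp Require Import all_boot all_order all_algebra.
From mathcomp Require Import complex.
From mathcomp Require Import all_classical all_reals all_analysis.

Set Implicit Arguments.
Unset Strict Implicit.
Unset Printing Implicit Defensive.

Import Order.TTheory GRing.Theory Num.Theory.
Import numFieldNormedType.Exports.

Local Open Scope classical_set_scope.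
Local Open Scope ring_scope.

(* Scalars are R[i]. Norms of normed modules over R[i] take (real) values in
   R[i]; rnorm is the same norm with values in R. *)
Definition rnorm {R : realType} {V : normedZmodType R[i]} (v : V) : R :=
  complex.Re `|v|.

Lemma rnorm_ge0 {R : realType} (V : normedZmodType R[i]) (v : V) : 0 <= rnorm v.
Proof. by rewrite /rnorm; case: `|v| (normr_ge0 v) => a b /andP[]. Qed.

Lemma rnormE {R : realType} (V : normedZmodType R[i]) (v : V) :
  (rnorm v)%:C%C = `|v|.
Proof.
by rewrite /rnorm; case: `|v| (normr_ge0 v) => a b /andP[/eqP /= -> _].
Qed.

Lemma rnormD {R : realType} (V : normedZmodType R[i]) (v w : V) :
  rnorm (v + w) <= rnorm v + rnorm w.
Proof. by rewrite -lecR rmorphD /= !rnormE ler_normD. Qed.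

Lemma rnormZ {R : realType} (V : normedModType R[i]) (c : R[i]) (v : V) :
  rnorm (c *: v) = rnorm c * rnorm v.
Proof.
by apply: (@complexI R); rewrite rmorphM /= !rnormE normrZ.
Qed.

Lemma rnorm0 {R : realType} (V : normedZmodType R[i]) : rnorm (0 : V) = 0.
Proof. by rewrite /rnorm normr0. Qed.

(* Following the library's Dot forms, the inner product is linear in its first
   argument and conjugate-linear in its second one. *)
Record hilbertType (R : realType) := HilbertType {
  hilbert_sort :> completeNormedModType R[i];
  hdot : {dot hilbert_sort for Num.conj};
  hdot_norm : forall u : hilbert_sort, `|u| ^+ 2 = hdot u u
}.

Arguments hdot {R h}.

Section BoundedOperators.
Context {R : realType} (H : hilbertType R).
Implicit Types (f g : H -> H).

Definition bounded_linear_op f : Prop :=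
  linear f /\ exists k : R, forall u, rnorm (f u) <= k * rnorm u.

Definition bounded_linear_pred : {pred H -> H} :=
  fun f => `[< bounded_linear_op f >].

Lemma bounded_linear_predP f :
  reflect (bounded_linear_op f) (f \in bounded_linear_pred).
Proof. exact: asboolP. Qed.

Lemma bounded_linear_submod : submod_closed bounded_linear_pred.
Proof.
split.
  apply/bounded_linear_predP; split=> [a u v|]; first by rewrite /= scaler0 addr0.
  by exists 0 => u; rewrite mul0r rnorm0.
move=> a f g /bounded_linear_predP[lf [k kf]] /bounded_linear_predP[lg [l lgb]].
apply/bounded_linear_predP; split=> [b u v|].
  rewrite !fctE lf lg !scalerDr !scalerA (mulrC a b) -!addrA; congr (_ + _).
  by rewrite addrCA.
exists (rnorm a * k + l) => u.
rewrite mulrDl -mulrA; apply: (le_trans (rnormD _ _)); apply: lerD => //.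
by rewrite rnormZ ler_wpM2l ?rnorm_ge0.
Qed.

HB.instance Definition _ :=
  GRing.isSubmodClosed.Build R[i] (H -> H) bounded_linear_pred
    bounded_linear_submod.

Record bop := Bop { bop_fun :> H -> H; _ : bop_fun \in bounded_linear_pred }.

HB.instance Definition _ := [isSub for bop_fun].
HB.instance Definition _ := [Choice of bop by <:].
HB.instance Definition _ := [SubChoice_isSubLmodule of bop by <:].

Lemma bopP (T : bop) : bounded_linear_op T.
Proof. by case: T => f /= /bounded_linear_predP. Qed.

Lemma bop_ext (S T : bop) : (S : H -> H) =1 T -> S = T.
Proof. by move=> ST; apply: val_inj; apply/funext. Qed.

Lemma idop_subproof : idfun \in bounded_linear_pred.
Proof.
by apply/bounded_linear_predP; split=> //; exists 1 => u; rewrite mul1r.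
Qed.

Definition idop : bop := Bop idop_subproof.

Lemma compop_subproof (S T : bop) : S \o T \in bounded_linear_pred.
Proof.
have [lS [k kS]] := bopP S; have [lT [l kT]] := bopP T.
apply/bounded_linear_predP; split=> [a u v|]; first by rewrite /= lT lS.
exists (`|k| * l) => u; apply: (le_trans (kS _)).
apply: (@le_trans _ _ (`|k| * rnorm (T u))).
  by rewrite ler_wpM2r ?rnorm_ge0 ?ler_norm.
by rewrite -mulrA ler_wpM2l.
Qed.

Definition compop (S T : bop) : bop := Bop (compop_subproof S T).

Lemma compopA : associative compop.
Proof. by move=> S T U; apply: bop_ext. Qed.

Lemma compop1l : left_id idop compop.
Proof. by move=> T; apply: bop_ext. Qed.

Lemma compop1r : right_id idop compop.
Proof. by move=> T; apply: bop_ext. Qed.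

Lemma compopDl : left_distributive compop +%R.
Proof. by move=> S T U; apply: bop_ext. Qed.

Lemma compopDr : right_distributive compop +%R.
Proof.
move=> S T U; apply: bop_ext => u.
have [lS _] := bopP S.
by have := lS 1 (T u) (U u); rewrite !scale1r.
Qed.

(* B(H) is the zero ring when H = 0, hence pzRing and not nzRing. *)
HB.instance Definition _ := GRing.Zmodule_isPzRing.Build bop
  compopA compop1l compop1r compopDl compopDr.

Definition opnorm (T : bop) : R :=
  sup [set rnorm (T u) | u in [set u | rnorm u <= 1]].

Definition is_adjoint (T S : bop) : Prop :=
  forall u v : H, hdot (T u) v = hdot u (S v).

(* Exists and is unique by the Riesz representation theorem. *)
Definition adjoint (T : bop) : bop := xget 0 (is_adjoint T).

Definition unitary (T : bop) : Prop :=
  adjoint T * T = 1 /\ T * adjoint T = 1.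

Definition op_cvg (S : nat -> bop) (T : bop) : Prop :=
  (fun n => opnorm (S n - T)) @ \oo --> (0 : R).

End BoundedOperators.

Section NormalStates.
Context {R : realType} (H : hilbertType R).

Definition square_summable (u : nat -> H) : Prop :=
  cvgn (series (fun n => rnorm (u n) ^+ 2)).

Definition uw_functional (uv : (nat -> H) * (nat -> H)) (T : bop H) : R[i] :=
  limn (series (fun n => hdot (T (uv.1 n)) (uv.2 n) : R[i]^o)).

(* Continuity for the ultraweak topology, i.e. the locally convex topology
   generated by the seminorms |uw_functional (u, v)| with u and v
   square-summable. The predual of B(H) is the space of the ultraweakly
   continuous linear functionals. *)
Definition ultraweakly_continuous (phi : bop H -> R[i]) : Prop :=
  forall (T : bop H) (e : R), 0 < e ->
  exists (F : set ((nat -> H) * (nat -> H))) (d : R),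
    [/\ finite_set F, 0 < d,
        forall uv, F uv -> square_summable uv.1 /\ square_summable uv.2 &
        forall S : bop H,
          (forall uv, F uv -> rnorm (uw_functional uv (S - T)) < d) ->
          rnorm (phi S - phi T) < e].

(* The order on R[i] is partial: 0 <= z means that z is real and
   nonnegative. *)
Definition normal_state (phi : {scalar (bop H)}) : Prop :=
  [/\ forall T : bop H, 0 <= phi (adjoint T * T), phi 1 = 1 &
      ultraweakly_continuous phi].

End NormalStates.

Section StandardModule.
Context {R : realType} {H : hilbertType R}.
Local Notation A := (bop H).
Implicit Types (x y : nat -> A) (E M : set (nat -> A)).

Definition ip_partial x y (n : nat) : A := \sum_(j < n) adjoint (x j) * y j.

Definition l2 : set (nat -> A) :=
  [set x | exists T, op_cvg (ip_partial x x) T].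

(* For x and y in l2 the series converges, and its norm limit is unique. *)
Definition l2_ip x y : A := xget 0 (op_cvg (ip_partial x y)).

Definition l2_norm x : R := Num.sqrt (opnorm (l2_ip x x)).

Definition l2_act x (a : A) : nat -> A := fun j => x j * a.

Definition l2_bounded E : Prop :=
  E `<=` l2 /\ exists k : R, forall x, E x -> l2_norm x <= k.

Definition balanced E : Prop :=
  forall x u, E x -> unitary u -> E (l2_act x u).

Definition closed_submodule M : Prop :=
  [/\ M `<=` l2, M 0,
      forall x y, M x -> M y -> M (x + y),
      forall x a, M x -> M (l2_act x a) &
      forall x, l2 x ->
        (forall e : R, 0 < e -> exists2 y, M y & l2_norm (x - y) < e) -> M x].

Definition free_ip n (a b : 'I_n -> A) : A := \sum_(i < n) adjoint (a i) * b i.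

(* An isomorphism of Hilbert modules: bijective, A-linear and preserving the
   A-valued inner products. *)
Definition free_iso n (f : ('I_n -> A) -> (nat -> A)) M : Prop :=
  [/\ set_bij [set: 'I_n -> A] M f,
      forall a b, f (a + b) = f a + f b,
      forall a (c : A), f (fun i => a i * c) = l2_act (f a) c &
      forall a b, l2_ip (f a) (f b) = free_ip a b].

Definition free_fg_submodule M : Prop :=
  closed_submodule M /\ exists n (f : ('I_n -> A) -> (nat -> A)), free_iso f M.

(* For E bounded, the suprema below are over bounded sets, which are nonempty
   unless E is; the library's sup of the empty set is 0. *)
Definition dist_to M x : R := inf [set l2_norm (x - y) | y in M].

Definition lambda E : R :=
  inf [set eta : R | 0 < eta /\
         exists2 M, free_fg_submodule M & sup [set dist_to M x | x in E] < eta].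

Definition sup_norm E : R := sup [set l2_norm x | x in E].

(* The series converges whenever phi is a normal state, x is in l2 and the
   phi (adjoint (y j) * y j) are bounded. *)
Definition seminorm (phi : {scalar A}) y x : \bar R :=
  sqrte (\sum_(0 <= j <oo) (rnorm (phi (adjoint (y j) * x j)) ^+ 2)%:E)%E.

Definition P_seminorms : set ((nat -> A) -> \bar R) :=
  [set p | exists (phi : {scalar A}) y,
     [/\ normal_state phi,
         ereal_sup [set (complex.Re (phi (adjoint (y j) * y j)))%:E
                   | j in [set: nat]] = 1%E &
         p = seminorm phi y]].

(* Supremum in [0, +oo], where the empty set has supremum 0. *)
Definition ereal_sup0 (S : set (\bar R)) : \bar R := ereal_sup (0%E |` S).

Definition I_meas E (p : (nat -> A) -> \bar R) : \bar R :=
  ereal_sup0 [set e%:E | e in [set e : R | 0 < e /\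
    exists S : set (nat -> A),
      [/\ S `<=` E, infinite_set S &
          forall x' x'', S x' -> S x'' -> x' <> x'' ->
            (e%:E <= p (x' - x'')%R)%E]]].

Definition Istar E : \bar R := ereal_sup0 [set I_meas E p | p in P_seminorms].

End StandardModule.

(* Main.v *)
From HB Require Import structures.
Require Import Defs.
From mathcomp Require Import all_boot all_order all_algebra.
From mathcomp Require Import complex ring lra.
From mathcomp Require Import all_classical all_reals all_analysis.

Set Implicit Arguments.
Unset Strict Implicit.
Unset Printing Implicit Defensive.

Import Order.TTheory GRing.Theory Num.Theory.
Import numFieldNormedType.Exports.

Local Open Scope classical_set_scope.
Local Open Scope ring_scope.

(** Both [lambda E <= sup_norm E] and [lambda E <= Istar E] hold, and the product
    of these two inequalities is the theorem.

    The first bound, [lambda_le_sup_norm], holds because a submodule contains 0.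
    The second, [lambda_le_Istar], is a gliding hump argument. Let [0 < c] with
    [c < lambda E]. The sequences supported on the first [n] coordinates form a
    free finitely generated submodule, so for every [n] some [x] in [E] has a tail
    of norm more than [c] after the coordinate [n]. The square of this norm is the
    norm of a positive operator, hence is nearly attained by its quadratic form:
    there is a unit vector [u] of the Hilbert space with
    [\sum_(j >= n) |x_j u|^2 > c^2] ([far_from_supported_below]). Because [E] is
    balanced and unitaries act transitively on unit vectors
    ([unitary_transitive]), [u] can be replaced by one unit vector [h] that does
    not depend on [n].

    Repeating this with larger and larger [n] produces elements [X 0], [X 1], ...
    of [E] and consecutive blocks of indices such that the [k]-th block carries
    more than [c^2] of the series of the [|X k j h|^2], while the part of that
    series after the block is negligible. Let [y j] be the rank one operator that
    sends [h] to the direction of [X k j h], where [k] is the block containing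
    [j]. The seminorm of the vector state of [h] and of [y] then separates the
    [X k] by almost [c] ([gliding_hump]), so [Istar E] is at least almost [c].

    The operator norm and the adjoints in the definitions are handled through the
    inner product of the Hilbert space. In particular the existence of adjoints
    rests on the Riesz representation theorem ([riesz]), proved here by minimising
    [|u|^2 - 2 g u]. *)

(** * Real inner products *)

Section InnerProduct.
Context {R : realType} {H : hilbertType R}.
Implicit Types (u v w : H) (t : R).

(** Estimates and limits are carried out with the real part of the inner
    product, which is symmetric and real-bilinear; [hdot_ext] returns to complex
    identities. *)
Definition rdot u v : R := complex.Re (hdot u v).

Lemma hdotC u v : hdot u v = (hdot v u)^*.
Proof. by rewrite (hermC (hdot : {dot H for Num.conj})) expr0 mul1r. Qed.

Lemma hdotDl u v w : hdot (u + v) w = hdot u w + hdot v w.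
Proof. exact: linearDl. Qed.

Lemma hdotZl a u v : hdot (a *: u) v = a * hdot u v.
Proof. by rewrite linearZl_LR. Qed.

Lemma hdotZr a u v : hdot u (a *: v) = a^* * hdot u v.
Proof. by rewrite linearZr_LR. Qed.

Lemma rdotC u v : rdot u v = rdot v u.
Proof. by rewrite /rdot hdotC; case: (hdot v u). Qed.

Lemma rdotDl u v w : rdot (u + v) w = rdot u w + rdot v w.
Proof. by rewrite /rdot hdotDl raddfD. Qed.

Lemma rdotDr u v w : rdot w (u + v) = rdot w u + rdot w v.
Proof. by rewrite !(rdotC w) rdotDl. Qed.

Lemma rdotZl t u v : rdot (t%:C%C *: u) v = t * rdot u v.
Proof. by rewrite /rdot hdotZl; case: (hdot u v) => a b /=; rewrite mul0r subr0. Qed.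

Lemma rdotZr t u v : rdot u (t%:C%C *: v) = t * rdot u v.
Proof. by rewrite !(rdotC u) rdotZl. Qed.

Lemma rdotNl u v : rdot (- u) v = - rdot u v.
Proof. by rewrite /rdot linearNl raddfN. Qed.

Lemma rdotNr u v : rdot v (- u) = - rdot v u.
Proof. by rewrite !(rdotC v) rdotNl. Qed.

Lemma rdotBl u v w : rdot (u - v) w = rdot u w - rdot v w.
Proof. by rewrite rdotDl rdotNl. Qed.

Lemma rdotBr u v w : rdot w (u - v) = rdot w u - rdot w v.
Proof. by rewrite rdotDr rdotNr. Qed.

Lemma Im_hdot u v : complex.Im (hdot u v) = - rdot ('i%C *: u) v.
Proof.
by rewrite /rdot hdotZl; case: (hdot u v) => a b /=; rewrite mul0r mul1r sub0r opprK.
Qed.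

Lemma hdotuu u : hdot u u = ((rnorm u ^+ 2)%:C)%C.
Proof. by rewrite -hdot_norm -rnormE rmorphXn. Qed.

Lemma rdotuu u : rdot u u = rnorm u ^+ 2.
Proof. by rewrite /rdot hdotuu. Qed.

Lemma rnormN (V : normedZmodType R[i]) (v : V) : rnorm (- v) = rnorm v.
Proof. by rewrite /rnorm normrN. Qed.

Lemma rnormB (V : normedZmodType R[i]) (v w : V) : rnorm (v - w) = rnorm (w - v).
Proof. by rewrite -rnormN opprB. Qed.

Lemma rnorm_eq0 (V : normedZmodType R[i]) (v : V) : (rnorm v == 0) = (v == 0).
Proof. by rewrite -[RHS]normr_eq0 -rnormE; rewrite (inj_eq (@complexI R) _ 0). Qed.

Lemma rnorm_real t : rnorm (t%:C%C) = `|t|.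
Proof. by rewrite /rnorm normc_def /= expr0n addr0 sqrtr_sqr. Qed.

Lemma rnorm_sqD u v :
  rnorm (u + v) ^+ 2 = rnorm u ^+ 2 + 2 * rdot u v + rnorm v ^+ 2.
Proof. rewrite -!rdotuu rdotDl !rdotDr (rdotC v u); ring. Qed.

Lemma rnorm_sqZ t u : rnorm (t%:C%C *: u) ^+ 2 = t ^+ 2 * rnorm u ^+ 2.
Proof. by rewrite rnormZ exprMn rnorm_real real_normK// num_real. Qed.

(** The discriminant inequality. With [e] a squared norm it gives the
    Cauchy-Schwarz inequality; with [e] the defect of an almost minimal vector it
    gives the approximate Euler equation in [riesz]. *)
Lemma discr_bound (e b c : R) : 0 <= c ->
  (forall t, 0 <= e + 2 * t * b + t ^+ 2 * c) -> b ^+ 2 <= e * c.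
Proof.
move=> c0 P; have [c0'|cp] := eqVneq c 0.
  have e0 : 0 <= e by move: (P 0); rewrite expr0n/= mulr0 mul0r addr0 mul0r addr0.
  have [->|b0] := eqVneq b 0; first by rewrite expr0n /= c0' mulr0.
  (* If [c = 0] the polynomial is affine, and takes the value [-1] here. *)
  move: (P (- (e + 1) / (2 * b))); rewrite c0' mulr0 addr0.
  have -> : e + 2 * (- (e + 1) / (2 * b)) * b = -1 by field; rewrite b0.
  by rewrite lerNr oppr0 ler10.
have {}cp : 0 < c by rewrite lt_def cp.
(* The minimum of the polynomial. *)
move: (P (- b / c)).
have -> : e + 2 * (- b / c) * b + (- b / c) ^+ 2 * c = (e * c - b ^+ 2) / c.
  by field; rewrite gt_eqF.
by rewrite pmulr_lge0 ?invr_gt0// subr_ge0.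
Qed.

Lemma rdot_CauchySchwarz u v : `|rdot u v| <= rnorm u * rnorm v.
Proof.
rewrite -ler_sqr ?nnegrE ?mulr_ge0 ?rnorm_ge0// real_normK ?num_real// exprMn.
apply: discr_bound; first exact: exprn_ge0 (rnorm_ge0 _).
move=> t; have := sqr_ge0 (rnorm (u + t%:C%C *: v)).
by rewrite rnorm_sqD rnorm_sqZ rdotZr mulrA.
Qed.

(** A complex inner product is determined by its real part, because the
    imaginary part is the real part after multiplication by ['i]. *)
Lemma hdot_ext (f : H -> H) v w : linear f ->
  (forall u, rdot (f u) v = rdot u w) -> forall u, hdot (f u) v = hdot u w.
Proof.
move=> lf fE u; apply/eqP; rewrite eq_complex; apply/andP; split.
  exact/eqP/fE.
rewrite !Im_hdot -fE; have f0 : f 0 = 0.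
  have := lf 1 0 0; rewrite !scale1r addr0 => /eqP.
  by rewrite -[X in X == _]addr0 (inj_eq (addrI _)) eq_sym => /eqP.
by have := lf 'i%C u 0; rewrite f0 !addr0 => ->.
Qed.

End InnerProduct.

(** * The Riesz representation theorem and adjoints *)

Section Riesz.
Context {R : realType} {H : hilbertType R}.
Implicit Types (u v w : H) (t : R).

Lemma cvg_rnormP (u : nat -> H) w :
  (u @ \oo --> w) <-> ((fun n => rnorm (u n - w)) @ \oo --> (0 : R)).
Proof.
split=> [/cvgrPdist_lt uw|/cvgrPdist_lt uw]; apply/cvgrPdist_lt => e e0.
- have {}/uw : 0 < (e%:C)%C by rewrite ltcR.
  apply: filterS => n; rewrite sub0r normrN ger0_norm ?rnorm_ge0//.
  by rewrite -rnormE ltcR rnormB.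
- have ee : e = ((complex.Re e)%:C)%C.
    by case: e e0 => a b; rewrite ltcE/= => /andP[/eqP -> _].
  have {}/uw : 0 < complex.Re e by move: e0; rewrite ltcE => /andP[].
  apply: filterS => n; rewrite sub0r normrN ger0_norm ?rnorm_ge0//.
  by rewrite -rnormE ee ltcR rnormB.
Qed.

(** Completeness, for the modulus of convergence that the minimising sequence of
    [riesz] has. *)
Lemma cauchy_inv_cvg (u : nat -> H) :
  (forall n m, rnorm (u n - u m) <= n.+1%:R^-1 + m.+1%:R^-1) ->
  exists w, (fun n => rnorm (u n - w)) @ \oo --> (0 : R).
Proof.
move=> uC; suff /cvg_ex[w /cvg_rnormP uw] : cvgn u by exists w.
apply: cauchy_cvg; apply: cauchy_exP => e e0.
have ee : e = ((complex.Re e)%:C)%C.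
  by case: e e0 => a b; rewrite ltcE/= => /andP[/eqP -> _].
have er : 0 < complex.Re e by move: e0; rewrite ltcE => /andP[].
have : (@harmonic R) @ \oo --> (0 : R) by exact: cvg_harmonic.
move=> /cvgrPdist_lt/(_ _ (divr_gt0 er (ltr0Sn R 1))) [N _ hN].
exists (u N); exists N => // n /= Nn.
rewrite -ball_normE/= -rnormE ee ltcR; apply: (le_lt_trans (uC _ _)).
rewrite [ltRHS]splitr; apply: ltrD; [move: (hN N (leqnn _))|move: (hN n Nn)];
  by rewrite sub0r normrN ger0_norm// /harmonic/= ?invr_ge0.
Qed.

(** Riesz representation for the underlying real Hilbert space. The vector
    minimises [J u = |u|^2 - 2 g u]: an almost minimal [u] satisfies the
    Euler equation [rdot u h = g h] up to a small multiple of [|h|], which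
    makes a minimising sequence Cauchy and its limit represent [g]. *)
Lemma riesz (g : H -> R) (k : R) :
  (forall u v, g (u + v) = g u + g v) ->
  (forall t u, g (t%:C%C *: u) = t * g u) ->
  (forall u, `|g u| <= k * rnorm u) ->
  exists w, forall u, g u = rdot u w.
Proof.
move=> gD gZ gb; pose J u := rnorm u ^+ 2 - 2 * g u.
have Jlb u : - k ^+ 2 <= J u.
  have : g u <= k * rnorm u by apply: le_trans (gb u); exact: ler_norm.
  by have := sqr_ge0 (rnorm u - k); rewrite /J; nra.
have infJ : has_inf (range J).
  by split; [exists (J 0), 0|exists (- k ^+ 2) => _ [u _ <-]].
set m := inf (range J).
have mJ u : m <= J u by apply: ge_inf; [exact: infJ.2|exists u].
have /choice[u_ uP] : forall n, exists u, J u < m + (n.+1%:R^-1) ^+ 2.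
  move=> n; have e0 : 0 < (n.+1%:R^-1 : R) ^+ 2 by rewrite exprn_gt0.
  by have [_ [u _ <-] Ju] := inf_adherent e0 infJ; exists u.
have euler n h : `|rdot (u_ n) h - g h| <= n.+1%:R^-1 * rnorm h.
  rewrite -ler_sqr ?nnegrE ?mulr_ge0 ?rnorm_ge0// real_normK ?num_real//.
  rewrite exprMn; apply: discr_bound; first exact: exprn_ge0 (rnorm_ge0 _).
  move=> t; have := mJ (u_ n + t%:C%C *: h); have := uP n; rewrite /J.
  rewrite rnorm_sqD rnorm_sqZ rdotZr gD gZ => A B.
  have := lt_le_trans A (lerD B (lexx _)) => C.
  apply: ltW; rewrite -subr_gt0 in C; apply: lt_le_trans C _.
  rewrite le_eqVlt; apply/orP; left; apply/eqP; ring.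
have ucau n p : rnorm (u_ n - u_ p) <= n.+1%:R^-1 + p.+1%:R^-1.
  have [->|nz] := eqVneq (u_ n - u_ p) 0.
    by rewrite rnorm0 addr_ge0 ?invr_ge0.
  have pos : 0 < rnorm (u_ n - u_ p) by rewrite lt_def rnorm_eq0 nz rnorm_ge0.
  rewrite -(ler_pM2r pos) -expr2 -rdotuu mulrDl rdotBl.
  have := euler n (u_ n - u_ p); have := euler p (u_ n - u_ p).
  move: (n.+1%:R^-1 * _) (p.+1%:R^-1 * _) (g _) => a b c.
  rewrite !ler_norml => /andP[A B] /andP[C D]; lra.
have [w uw] := cauchy_inv_cvg ucau.
exists w => h; apply/eqP; rewrite -subr_eq0 -normr_le0; apply/ler_addgt0Pl.
move=> e e0; rewrite addr0.
pose d := e / (2 * (rnorm h + 1)).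
have hp : 0 < rnorm h + 1 by rewrite ltr_wpDl ?rnorm_ge0.
have d0 : 0 < d by rewrite divr_gt0 ?mulr_gt0.
have /cvgrPdist_lt/(_ _ d0)[N1 _ hN1] := uw.
have : (@harmonic R) @ \oo --> (0 : R) by exact: cvg_harmonic.
move=> /cvgrPdist_lt/(_ _ d0) [N2 _ hN2].
pose n := maxn N1 N2.
have := hN1 n (leq_maxl _ _); have := hN2 n (leq_maxr _ _).
rewrite !sub0r !normrN ger0_norm ?invr_ge0// ger0_norm ?rnorm_ge0// /harmonic /=.
move=> A B; have C := euler n h; have D := rdot_CauchySchwarz (u_ n - w) h.
rewrite rdotBl (rdotC w) in D.
have -> : g h - rdot h w = (rdot (u_ n) h - rdot h w) - (rdot (u_ n) h - g h).
  by ring.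
apply: (le_trans (ler_normB _ _)); apply: (le_trans (lerD D C)).
rewrite -mulrDl; apply: (@le_trans _ _ ((2 * d) * (rnorm h + 1))).
  apply: ler_pM; rewrite ?addr_ge0 ?invr_ge0 ?rnorm_ge0 ?lerDl//.
  by rewrite mulr_natl mulr2n; apply: lerD; exact: ltW.
rewrite /d le_eqVlt; apply/orP; left; apply/eqP; field.
by rewrite gt_eqF.
Qed.

Lemma bop_is_linear (T : bop H) : linear T.
Proof. exact: (bopP T).1. Qed.

Lemma bopD (T : bop H) u v : T (u + v) = T u + T v.
Proof. by have := bop_is_linear T 1 u v; rewrite !scale1r. Qed.

Lemma bop0 (T : bop H) : T 0 = 0.
Proof.
have := bopD T 0 0; rewrite addr0 => /eqP.
by rewrite -[X in X == _]addr0 (inj_eq (addrI _)) eq_sym => /eqP.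
Qed.

Lemma bopZ (T : bop H) a u : T (a *: u) = a *: T u.
Proof. by have := bop_is_linear T a u 0; rewrite bop0 !addr0. Qed.

Lemma bopN (T : bop H) u : T (- u) = - T u.
Proof. by rewrite -scaleN1r bopZ scaleN1r. Qed.

Lemma bop_bound (T : bop H) :
  exists2 k : R, 0 <= k & forall u, rnorm (T u) <= k * rnorm u.
Proof.
have [_ [k kT]] := bopP T; exists `|k| => // u; apply: (le_trans (kT u)).
by rewrite ler_wpM2r ?rnorm_ge0// ler_norm.
Qed.

(** [S v] represents [fun u => rdot (T u) v]. Its additivity, homogeneity and
    boundedness follow by testing against the vectors [S (a *: u + v) - _] and
    [S v] themselves. *)
Lemma adjoint_exists (T : bop H) : exists S, is_adjoint T S.
Proof.
have [k k0 kT] := bop_bound T.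
have /choice[S SE] : forall v, exists w, forall u, rdot (T u) v = rdot u w.
  move=> v; apply: (@riesz _ (k * rnorm v)) => [u u'|t u|u].
  - by rewrite bopD rdotDl.
  - by rewrite bopZ rdotZl.
  - apply: (le_trans (rdot_CauchySchwarz _ _)).
    by rewrite mulrAC ler_wpM2r ?rnorm_ge0.
have {}SE u v : hdot (T u) v = hdot u (S v).
  exact: (hdot_ext (bop_is_linear T) (SE v)).
have lS : linear S.
  move=> a u v; apply/eqP; rewrite -subr_eq0 -rnorm_eq0 -sqrf_eq0 -rdotuu.
  move: {1}(_ - _) => w; rewrite rdotBr rdotDr /rdot hdotZr -!SE.
  by rewrite linearDr/= hdotZr raddfD/= subrr.
have Sb : exists l : R, forall u, rnorm (S u) <= l * rnorm u.
  exists k => v; have [->|nz] := eqVneq (S v) 0.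
    by rewrite rnorm0 mulr_ge0 ?rnorm_ge0.
  have pos : 0 < rnorm (S v) by rewrite lt_def rnorm_eq0 nz rnorm_ge0.
  rewrite -(ler_pM2r pos) -expr2 -rdotuu {1}/rdot -SE.
  apply: (le_trans (ler_norm _)); apply: (le_trans (rdot_CauchySchwarz _ _)).
  by rewrite mulrAC ler_wpM2r ?rnorm_ge0.
have SP : S \in @bounded_linear_pred R H by apply/bounded_linear_predP.
by exists (Bop SP).
Qed.

Lemma adjointP (T : bop H) : is_adjoint T (adjoint T).
Proof. by have [S] := adjoint_exists T; exact: xgetI. Qed.

Lemma hdot_adjoint (T : bop H) u v : hdot (adjoint T u) v = hdot u (T v).
Proof. by rewrite hdotC -adjointP -hdotC. Qed.

Lemma rdot_adjoint (T : bop H) u v : rdot (adjoint T u) v = rdot u (T v).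
Proof. by rewrite /rdot hdot_adjoint. Qed.

Lemma rdot_inj v w : (forall u, rdot u v = rdot u w) -> v = w.
Proof.
move=> vw; apply/eqP; rewrite -subr_eq0 -rnorm_eq0 -sqrf_eq0 -rdotuu rdotBr vw.
by rewrite subrr.
Qed.

Lemma adjoint_uniq (T S : bop H) : is_adjoint T S -> adjoint T = S.
Proof.
move=> TS; apply: bop_ext => v; apply: rdot_inj => u.
by rewrite /rdot -TS -adjointP.
Qed.

End Riesz.

(** * The operator norm *)

Section OperatorNorm.
Context {R : realType} {H : hilbertType R}.
Implicit Types (u v w : H) (S T : bop H).

Lemma opnorm_has_sup T :
  has_sup [set rnorm (T u) | u in [set u | rnorm u <= 1]].
Proof.
have [k k0 kT] := bop_bound T; split.
  by exists (rnorm (T 0)), 0; rewrite //= rnorm0 ler01.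
by exists k => _ [u /= u1 <-]; apply: (le_trans (kT u)); rewrite ler_piMr.
Qed.

Lemma opnorm_ge0 T : 0 <= opnorm T.
Proof.
apply: (@le_trans _ _ (rnorm (T 0))); first exact: rnorm_ge0.
by apply: ub_le_sup; [exact: (opnorm_has_sup T).2|exists 0; rewrite //= rnorm0 ler01].
Qed.

Lemma opnormP T u : rnorm (T u) <= opnorm T * rnorm u.
Proof.
have [->|nz] := eqVneq u 0; first by rewrite bop0 !rnorm0 mulr0.
have pos : 0 < rnorm u by rewrite lt_def rnorm_eq0 nz rnorm_ge0.
rewrite -ler_pdivrMr// mulrC -(gtr0_norm pos) -normfV -rnorm_real -rnormZ -bopZ.
apply: ub_le_sup; first exact: (opnorm_has_sup T).2.
by eexists; [|reflexivity]; rewrite /= rnormZ rnorm_real gtr0_norm ?invr_gt0// mulVf// gt_eqF.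
Qed.

Lemma opnorm_le T (c : R) : 0 <= c ->
  (forall u, rnorm (T u) <= c * rnorm u) -> opnorm T <= c.
Proof.
move=> c0 Tc; apply: ge_sup; first exact: (opnorm_has_sup T).1.
by move=> _ [u /= u1 <-]; apply: (le_trans (Tc u)); rewrite ler_piMr.
Qed.

Lemma opnorm0 : opnorm (0 : bop H) = 0.
Proof.
apply/eqP; rewrite eq_le opnorm_ge0 andbT; apply: opnorm_le => // u.
by rewrite mul0r (rnorm0 H).
Qed.

Lemma op_cvg_rdot (S_ : nat -> bop H) T u v :
  op_cvg S_ T -> (fun n => rdot (S_ n u) v) @ \oo --> rdot (T u) v.
Proof.
move=> ST; apply/cvgrPdist_lt => e e0; pose c := rnorm u * rnorm v + 1.
have c0 : 0 < c by rewrite ltr_wpDl ?mulr_ge0 ?rnorm_ge0.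
have /cvgrPdist_lt/(_ _ (divr_gt0 e0 c0)) := ST; apply: filterS => n.
rewrite sub0r normrN ger0_norm ?opnorm_ge0// ltr_pdivlMr// => STn.
rewrite distrC -rdotBl; apply: (le_lt_trans (rdot_CauchySchwarz _ _)).
apply: le_lt_trans STn; have := opnormP (S_ n - T) u => /= B.
apply: (@le_trans _ _ (opnorm (S_ n - T) * rnorm u * rnorm v)).
  by rewrite ler_wpM2r ?rnorm_ge0.
by rewrite -mulrA ler_wpM2l ?opnorm_ge0// lerDl.
Qed.

Lemma op_cvg_unique (S_ : nat -> bop H) T T' :
  op_cvg S_ T -> op_cvg S_ T' -> T = T'.
Proof.
move=> ST ST'; apply: bop_ext => u; apply: rdot_inj => v; rewrite !(rdotC v).
exact: norm_cvg_unique (op_cvg_rdot ST) (op_cvg_rdot ST').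
Qed.

Lemma op_cvg_near_cst (S_ : nat -> bop H) T N :
  (forall n, (N <= n)%N -> S_ n = T) -> op_cvg S_ T.
Proof.
move=> ST; apply/cvgrPdist_lt => e e0; exists N => // n /= /ST ->.
by rewrite subrr opnorm0 subrr normr0.
Qed.

(** A positive operator is bounded by its numerical range. Positivity is used
    at the vector [u - T u / c], which gives [|T u|^2 <= c <T u, u>]. *)
Lemma opnorm_le_numerical T (c : R) : 0 < c ->
  (forall u v, rdot (T u) v = rdot u (T v)) ->
  (forall u, 0 <= rdot (T u) u <= c * rnorm u ^+ 2) -> opnorm T <= c.
Proof.
move=> c0 Tsym Tc; apply: opnorm_le => [|u]; first exact: ltW.
rewrite -ler_sqr ?nnegrE ?mulr_ge0 ?rnorm_ge0 ?(ltW c0)// exprMn.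
have /andP[+ _] := Tc (u - (c^-1)%:C%C *: T u).
have /andP[_] := Tc (T u); have /andP[_] := Tc u.
rewrite bopD bopN bopZ !(rdotBl,rdotBr,rdotZl,rdotZr) (Tsym (T u) u) rdotuu.
move: (rdot (T u) u) (rdot (T (T u)) _) (rnorm (T u) ^+ 2) => a b r.
move=> A B C.
have D : r <= c * a.
  have : 0 <= c * (a - c^-1 * r - (c^-1 * r - c^-1 * (c^-1 * b))) by rewrite mulr_ge0// ltW.
  have -> : c * (a - c^-1 * r - (c^-1 * r - c^-1 * (c^-1 * b))) = c * a - 2 * r + b / c.
    by field; rewrite gt_eqF.
  have : b / c <= r by rewrite ler_pdivrMr// mulrC.
  lra.
by apply: (le_trans D); rewrite expr2 -mulrA ler_wpM2l// ltW.
Qed.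

End OperatorNorm.

(** * The norm of the standard module *)

Section StandardModuleTheory.
Context {R : realType} {H : hilbertType R}.
Local Notation A := (bop H).
Implicit Types (x y z : nat -> A) (u v : H).

Lemma bop_sumE I (r : seq I) (F : I -> A) u :
  (\sum_(i <- r) F i) u = \sum_(i <- r) F i u.
Proof. by elim/big_ind2: _ => // a b c d <- <-. Qed.

Lemma rdot_suml I (r : seq I) (F : I -> H) v :
  rdot (\sum_(i <- r) F i) v = \sum_(i <- r) rdot (F i) v.
Proof.
elim/big_rec2: _ => [|i a b _ <-]; last by rewrite rdotDl.
by have := rdotBl (0 : H) 0 v; rewrite !subrr.
Qed.

Lemma rdot_ip_partial x y n u v :
  rdot (ip_partial x y n u) v = \sum_(0 <= j < n) rdot (y j u) (x j v).
Proof.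
rewrite /ip_partial bop_sumE rdot_suml big_mkord.
by apply: eq_bigr => j _; exact: rdot_adjoint.
Qed.

(** The operator-valued inner product [<x, x>] enters only through its diagonal
    matrix coefficients [<<x, x> u, u>], which are the series of the
    [|x_j u|^2]; these are the blocks of such a series. *)
Definition sqsum x u n m : R := \sum_(n <= j < m) rnorm (x j u) ^+ 2.

Lemma sqsum_ge0 x u n m : 0 <= sqsum x u n m.
Proof. by apply: sumr_ge0 => j _; rewrite exprn_ge0 ?rnorm_ge0. Qed.

Lemma sqsum_split x u n m p : (n <= m)%N -> (m <= p)%N ->
  sqsum x u n p = sqsum x u n m + sqsum x u m p.
Proof. by move=> nm mp; rewrite /sqsum (big_cat_nat nm mp). Qed.

Lemma rdot_ip_partial_diag x n u : rdot (ip_partial x x n u) u = sqsum x u 0 n.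
Proof. by rewrite rdot_ip_partial; apply: eq_bigr => j _; rewrite rdotuu. Qed.

Lemma l2_ip_cvg x y T : op_cvg (ip_partial x y) T -> l2_ip x y = T.
Proof. by move=> xT; apply: (op_cvg_unique (xgetI _ xT) xT). Qed.

Lemma l2P x : l2 x -> op_cvg (ip_partial x x) (l2_ip x x).
Proof. by move=> [T xT]; rewrite (l2_ip_cvg xT). Qed.

Lemma sqsum_cvg x u : l2 x -> sqsum x u 0 @ \oo --> rdot (l2_ip x x u) u.
Proof.
move=> /l2P /(@op_cvg_rdot _ _ _ _ u u); apply: cvg_trans.
rewrite (_ : sqsum x u 0 = (fun n => rdot (ip_partial x x n u) u)) //.
by apply/funext => n; rewrite rdot_ip_partial_diag.
Qed.

Lemma sqsum_le_lim x u n m : l2 x -> sqsum x u n m <= rdot (l2_ip x x u) u.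
Proof.
move=> /(@sqsum_cvg _ u) xu.
have nd : nondecreasing_seq (sqsum x u 0).
  by move=> p q pq; rewrite (sqsum_split x u (leq0n p) pq) lerDl sqsum_ge0.
rewrite -(cvg_lim (@Rhausdorff R) xu).
apply: le_trans (nondecreasing_cvgn_le nd (cvgP _ xu) m).
have [nm|/ltnW mn] := leqP n m; first by rewrite (sqsum_split x u (leq0n n) nm) lerDr sqsum_ge0.
by rewrite {1}/sqsum big_geq// sqsum_ge0.
Qed.

Lemma lim_le_sqsum x u c : l2 x -> (forall n, sqsum x u 0 n <= c) ->
  rdot (l2_ip x x u) u <= c.
Proof.
move=> /(@sqsum_cvg _ u) xu xc; rewrite -(cvg_lim (@Rhausdorff R) xu).
by apply: limr_le; [exact: cvgP xu|exact: nearW].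
Qed.

Lemma l2_ip_sym x u v : l2 x -> rdot (l2_ip x x u) v = rdot u (l2_ip x x v).
Proof.
move=> /l2P xT; have A := @op_cvg_rdot _ _ _ _ u v xT.
have := @op_cvg_rdot _ _ _ _ v u xT; rewrite (rdotC u) => B.
apply: norm_cvg_unique A _; apply: cvg_trans B.
rewrite (_ : (fun n => rdot (ip_partial x x n u) v) =
             (fun n => rdot (ip_partial x x n v) u)) //.
apply/funext => n; rewrite !rdot_ip_partial.
by apply: eq_bigr => j _; rewrite rdotC.
Qed.

Lemma sqr_l2_norm x : l2_norm x ^+ 2 = opnorm (l2_ip x x).
Proof. by rewrite sqr_sqrtr// opnorm_ge0. Qed.

Lemma l2_norm_ge0 x : 0 <= l2_norm x.
Proof. exact: sqrtr_ge0. Qed.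

Lemma sqsum_le_l2_norm x u n m : l2 x ->
  sqsum x u n m <= l2_norm x ^+ 2 * rnorm u ^+ 2.
Proof.
move=> lx; apply: (le_trans (sqsum_le_lim u n m lx)); rewrite sqr_l2_norm.
apply: (le_trans (ler_norm _)); apply: (le_trans (rdot_CauchySchwarz _ _)).
by rewrite expr2 mulrA ler_wpM2r ?rnorm_ge0// opnormP.
Qed.

(** The limit [<x, x>] is a positive operator, so its norm is controlled by the
    quadratic form; see [opnorm_le_numerical]. *)
Lemma l2_norm_le x c : l2 x -> 0 < c ->
  (forall u n, sqsum x u 0 n <= c ^+ 2 * rnorm u ^+ 2) -> l2_norm x <= c.
Proof.
move=> lx c0 xc; rewrite -ler_sqr ?nnegrE ?l2_norm_ge0 ?(ltW c0)// sqr_l2_norm.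
apply: opnorm_le_numerical; first by rewrite exprn_gt0.
  by move=> u v; exact: l2_ip_sym.
move=> u; apply/andP; split; last exact: lim_le_sqsum.
by apply: le_trans (sqsum_le_lim u 0 0 lx); exact: sqsum_ge0.
Qed.

Lemma ip_partial_tail x y N n : (forall j, (N <= j)%N -> x j = 0 \/ y j = 0) ->
  (N <= n)%N -> ip_partial x y n = ip_partial x y N.
Proof.
move=> xy0 Nn; rewrite /ip_partial -!(big_mkord xpredT (fun j => adjoint (x j) * y j)).
rewrite (big_cat_nat (leq0n N) Nn)/= [X in _ + X]big_nat_cond [X in _ + X]big1 ?addr0//.
move=> j; rewrite andbT => /andP[/xy0 [->|->] _]; last by rewrite mulr0.
rewrite (_ : adjoint 0 = 0) ?mul0r//; apply: adjoint_uniq => u v.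
by rewrite linear0l linear0r.
Qed.

Lemma l2_ip_finite x y N : (forall j, (N <= j)%N -> x j = 0 \/ y j = 0) ->
  op_cvg (ip_partial x y) (ip_partial x y N).
Proof.
by move=> xy0; apply: (@op_cvg_near_cst _ _ _ _ N) => n; exact: ip_partial_tail.
Qed.

Lemma l2_near_eq x z N : (forall j, (N <= j)%N -> z j = x j) -> l2 x -> l2 z.
Proof.
move=> zx [T xT]; exists (T + (ip_partial z z N - ip_partial x x N)).
have E n : (N <= n)%N -> ip_partial z z n =
    ip_partial x x n + (ip_partial z z N - ip_partial x x N).
  move=> Nn; rewrite /ip_partial.
  rewrite -!(big_mkord xpredT (fun j => adjoint (x j) * x j)).
  rewrite -!(big_mkord xpredT (fun j => adjoint (z j) * z j)).
  rewrite !(big_cat_nat (leq0n N) Nn)/=.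
  rewrite [RHS]addrC addrA subrK; congr (_ + _).
  by apply: eq_big_nat => j /andP[/zx -> _].
apply/cvgrPdist_lt => e e0; have /cvgrPdist_lt/(_ _ e0) := xT.
move=> [M _ hM]; exists (maxn M N) => // n /=; rewrite geq_max => /andP[Mn Nn].
by rewrite E// opprD addrACA subrr addr0; exact: hM.
Qed.

End StandardModuleTheory.

(** * The free submodules of finitely supported sequences *)

Section FreeSubmodules.
Context {R : realType} {H : hilbertType R}.
Local Notation A := (bop H).
Implicit Types (x y z : nat -> A) (u v : H).

(** The copy of [A^n] on the first [n] coordinates. *)
Definition supported_below (n : nat) : set (nat -> A) :=
  [set x | forall j, (n <= j)%N -> x j = 0].

Lemma supported_below_l2 n x : supported_below n x -> l2 x.
Proof.
by move=> xn; exists (ip_partial x x n); apply: l2_ip_finite => j /xn; left.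
Qed.

Lemma sqsum_coord x u j : sqsum x u j j.+1 = rnorm (x j u) ^+ 2.
Proof. by rewrite /sqsum big_nat1. Qed.

Lemma coord_le_l2_norm x u j : l2 x -> rnorm (x j u) <= l2_norm x * rnorm u.
Proof.
move=> lx; rewrite -ler_sqr ?nnegrE ?mulr_ge0 ?rnorm_ge0 ?l2_norm_ge0// exprMn.
by rewrite -sqsum_coord; exact: sqsum_le_l2_norm.
Qed.

Lemma supported_below_closed n : closed_submodule (supported_below n).
Proof.
split=> [x /supported_below_l2 //|j _ //|x y xn yn j nj|x a xn j nj|x lx xn j nj].
- by rewrite /= fctE xn// yn// addr0.
- by rewrite /l2_act xn// mul0r.
- apply: bop_ext => u; apply/eqP; rewrite -rnorm_eq0 eq_le rnorm_ge0 andbT.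
  apply/ler_addgt0Pl => e e0; rewrite addr0.
  have pos : 0 < rnorm u + 1 by rewrite ltr_wpDl ?rnorm_ge0.
  have [y yn xy] := xn _ (divr_gt0 e0 pos).
  have xyE i : (n <= i)%N -> (x - y) i = x i.
    by move=> /yn yi; rewrite !fctE yi subr0.
  have lxy : l2 (x - y) := l2_near_eq xyE lx.
  rewrite -xyE//; apply: (le_trans (coord_le_l2_norm u j lxy)).
  apply: (@le_trans _ _ (e / (rnorm u + 1) * (rnorm u + 1))).
    by apply: ler_pM; rewrite ?l2_norm_ge0 ?rnorm_ge0 ?lerDl// ltW.
  by rewrite divfK// gt_eqF.
Qed.

Definition extend_by_zero n (a : 'I_n -> A) : nat -> A :=
  fun j => oapp a 0 (insub j).

Lemma extend_by_zeroE n (a : 'I_n -> A) (i : 'I_n) : extend_by_zero a i = a i.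
Proof. by rewrite /extend_by_zero valK. Qed.

Lemma extend_by_zero_ge n (a : 'I_n -> A) j : (n <= j)%N -> extend_by_zero a j = 0.
Proof. by move=> nj; rewrite /extend_by_zero insubF// ltnNge nj. Qed.

Lemma supported_below_free n : free_fg_submodule (supported_below n).
Proof.
split; first exact: supported_below_closed.
exists n, (@extend_by_zero n); split=> [|a b|a c|a b].
- split=> [a _ j /extend_by_zero_ge //|a b _ _ ab|x xn].
    by apply/funext => i; rewrite -!extend_by_zeroE ab.
  exists (fun i => x i) => //; apply/funext => j.
  have [jn|nj] := ltnP j n; first exact: (extend_by_zeroE _ (Ordinal jn)).
  by rewrite extend_by_zero_ge// xn.
- apply/funext => j; rewrite /extend_by_zero !fctE.
  by case: insubP => //=; rewrite addr0.
- apply/funext => j; rewrite /extend_by_zero /l2_act.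
  by case: insubP => //=; rewrite mul0r.
- rewrite (l2_ip_cvg (l2_ip_finite (N := n) _)).
    by apply: eq_bigr => i _; rewrite !extend_by_zeroE.
  by move=> j nj; left; rewrite extend_by_zero_ge.
Qed.

Definition tail n x : nat -> A := fun j => if (j < n)%N then 0 else x j.

Lemma l2_tail n x : l2 x -> l2 (tail n x).
Proof. by apply: (@l2_near_eq _ _ _ _ n) => j nj; rewrite /tail ltnNge nj. Qed.

Lemma sqsum_tail n x u m : sqsum (tail n x) u 0 m <= sqsum x u n m.
Proof.
have z0 k : (k <= n)%N -> sqsum (tail n x) u 0 k = 0.
  move=> kn; rewrite /sqsum big_nat_cond big1// => j.
  rewrite andbT => /= jk.
  by rewrite /tail (leq_trans jk kn) (rnorm0 H) expr0n.
have [nm|/ltnW mn] := leqP n m; last by rewrite z0// sqsum_ge0.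
rewrite (sqsum_split _ u (leq0n n) nm) z0// add0r le_eqVlt; apply/orP; left.
apply/eqP; apply: eq_big_nat => j /andP[nj _].
by rewrite /tail ltnNge nj.
Qed.

Lemma sqsumZ x (t : R) u n m : sqsum x (t%:C%C *: u) n m = t ^+ 2 * sqsum x u n m.
Proof.
by rewrite /sqsum big_distrr/=; apply: eq_bigr => j _; rewrite bopZ rnorm_sqZ.
Qed.

Lemma sqsum_phase x (a : R[i]) u n m : rnorm a = 1 -> sqsum x (a *: u) n m = sqsum x u n m.
Proof.
by move=> a1; apply: eq_bigr => j _; rewrite bopZ rnormZ a1 mul1r.
Qed.

Lemma sqsum0 x n m : sqsum x 0 n m = 0.
Proof. by rewrite /sqsum big1// => j _; rewrite bop0 rnorm0 expr0n. Qed.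

Lemma dist_to_le M x y : M y -> dist_to M x <= l2_norm (x - y).
Proof.
move=> My; apply: ge_inf; last by exists y.
by exists 0 => _ [z _ <-]; exact: l2_norm_ge0.
Qed.

(** The distance is at most the norm of the tail left by truncation at [n], and
    that norm is seen, up to an arbitrarily small loss, by a single unit vector
    of the Hilbert space. *)
Lemma far_from_supported_below n x (c : R) : l2 x -> 0 < c ->
  c < dist_to (supported_below n) x ->
  exists u m, rnorm u = 1 /\ c ^+ 2 < sqsum x u n m.
Proof.
move=> lx c0 cd; apply: contrapT => no.
have unit_le u m : rnorm u = 1 -> sqsum x u n m <= c ^+ 2.
  by move=> u1; rewrite leNgt; apply/negP => big; apply: no; exists u, m.
have : l2_norm (tail n x) <= c.
  apply: (l2_norm_le (l2_tail n lx) c0) => u m.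
  apply: (le_trans (sqsum_tail _ _ _ _)).
  have [->|nz] := eqVneq u 0; first by rewrite sqsum0 mulr_ge0 ?sqr_ge0.
  have pos : 0 < rnorm u by rewrite lt_def rnorm_eq0 nz rnorm_ge0.
  rewrite -ler_pdivrMr ?exprn_gt0// mulrC -exprVn -sqsumZ unit_le//.
  by rewrite rnormZ rnorm_real gtr0_norm ?invr_gt0// mulVf// gt_eqF.
apply/negP; rewrite -ltNge; apply: (lt_le_trans cd).
have -> : tail n x = x - (x - tail n x) by rewrite subKr.
apply: dist_to_le => j nj; rewrite !fctE /tail ltnNge nj/=; exact: subrr.
Qed.

End FreeSubmodules.

(** * Rank one operators and unitaries *)

Section Operators.
Context {R : realType} {H : hilbertType R}.
Local Notation A := (bop H).
Implicit Types (e h u v w : H).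

(** The factor 2 comes from applying the real Cauchy-Schwarz inequality to the
    real and the imaginary part separately. *)
Lemma rnorm_hdot_le u v : rnorm (hdot u v) <= 2 * rnorm u * rnorm v.
Proof.
have i1 : rnorm ('i%C : R[i]) = 1 by rewrite /rnorm normc_def /= expr0n add0r expr1n sqrtr1.
have -> : hdot u v = ((complex.Re (hdot u v))%:C)%C + 'i%C * ((complex.Im (hdot u v))%:C)%C.
  by case: (hdot u v) => a b; rewrite [LHS]complexE.
apply: (le_trans (rnormD _ _)).
have -> (a b : R[i]) : rnorm (a * b) = rnorm a * rnorm b := rnormZ (V := R[i]^o) a b.
rewrite i1 mul1r !rnorm_real Im_hdot normrN mulrDl.
apply: (@le_trans _ _ (rnorm u * rnorm v + rnorm u * rnorm v)); last by lra.
apply: lerD; first exact: rdot_CauchySchwarz.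
by apply: (le_trans (rdot_CauchySchwarz _ _)); rewrite rnormZ i1 mul1r.
Qed.

Lemma rank_one_subproof e h : (fun u => hdot u h *: e) \in @bounded_linear_pred R H.
Proof.
apply/bounded_linear_predP; split=> [a u v|].
  by rewrite hdotDl hdotZl scalerDl scalerA.
exists (2 * rnorm h * rnorm e) => u; rewrite rnormZ mulrAC.
by rewrite ler_wpM2r ?rnorm_ge0// mulrAC rnorm_hdot_le.
Qed.

Definition rank_one e h : A := Bop (rank_one_subproof e h).

Lemma rank_oneE e h u : rank_one e h u = hdot u h *: e.
Proof. by []. Qed.

Lemma conjC_real (t : R) : ((t%:C)%C : R[i])^* = (t%:C)%C.
Proof. by apply/eqP; rewrite eq_complex /= oppr0 !eqxx. Qed.

(** The Householder reflection. For [w = 0] it is the identity, since the rank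
    one operator vanishes. *)
Definition reflection w : A :=
  1 - ((2 / rnorm w ^+ 2)%:C)%C *: rank_one w w.

Lemma reflectionE w u :
  reflection w u = u - (((2 / rnorm w ^+ 2)%:C)%C * hdot u w) *: w.
Proof. by rewrite -scalerA. Qed.

Lemma reflection_unitary w : unitary (reflection w).
Proof.
have -> : unitary (reflection w) =
  (adjoint (reflection w) * reflection w = 1 /\ reflection w * adjoint (reflection w) = 1) by [].
rewrite (_ : adjoint (reflection w) = reflection w); last first.
  apply: adjoint_uniq => u v; rewrite !reflectionE.
  move: (2 / _) => k; rewrite linearBl linearBr/= hdotZl hdotZr.
  rewrite [(_ * hdot v w)^*]rmorphM/= conjC_real -hdotC; congr (_ - _).
  by rewrite mulrAC.
suff E : reflection w * reflection w = 1 by [].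
apply: bop_ext => u; rewrite -[LHS]/(reflection w (reflection w u)) -[RHS]/u.
have [->|nz] := eqVneq w 0; first by rewrite !reflectionE !scaler0 !subr0.
have Rw : hdot (reflection w u) w = - hdot u w.
  rewrite reflectionE linearBl/= hdotZl hdotuu mulrAC -rmorphM/=.
  rewrite divfK ?sqrf_eq0 ?rnorm_eq0// rmorph_nat.
  by rewrite mulr_natl mulr2n opprD addrA subrr sub0r.
by rewrite (reflectionE w (reflection w u)) Rw reflectionE mulrN scaleNr opprK subrK.
Qed.

(** The reflection along [u - a *: v] exchanges [u] and [a *: v] as soon as their
    inner product is real, and the phase [a] is chosen to make it so. The phase
    can stay in the conclusion because the norms [|x_j u|] do not see it. *)
Lemma unitary_transitive u v : rnorm u = 1 -> rnorm v = 1 ->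
  exists U a, [/\ unitary U, rnorm a = 1 & U u = a *: v].
Proof.
move=> u1 v1; pose c := hdot u v.
have [a a1 [r rE]] : exists2 a : R[i], rnorm a = 1 & exists r : R, hdot u (a *: v) = r%:C%C.
  have [c0|nz] := eqVneq c 0.
    exists 1; first by rewrite rnorm_real normr1.
    by exists 0; rewrite hdotZr -/c c0 mulr0.
  have nz' : `|c| != 0 by rewrite normr_eq0.
  exists (c / `|c|); first by rewrite /rnorm normf_div normr_id divff.
  exists (rnorm c); rewrite hdotZr rnormE -/c rmorphM/= fmorphV/= (conj_Creal (normr_real c)).
  by rewrite mulrAC -normCKC expr2 mulfK.
exists (reflection (u - a *: v)), a; split=> //; first exact: reflection_unitary.
have [w0|nz] := eqVneq (u - a *: v) 0.
  by rewrite reflectionE w0 scaler0 subr0; apply/eqP; rewrite -subr_eq0 w0.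
have W : rnorm (u - a *: v) ^+ 2 = 2 - 2 * r.
  rewrite rnorm_sqD rnormN rnormZ a1 mul1r u1 v1 rdotNr /rdot rE /=; ring.
have k1 : ((2 / rnorm (u - a *: v) ^+ 2)%:C)%C * hdot u (u - a *: v) = 1.
  have -> : hdot u (u - a *: v) = ((1 - r)%:C)%C.
    by rewrite linearBr/= rE hdotuu u1 expr1n rmorphB.
  rewrite -rmorphM/= (_ : 1 - r = rnorm (u - a *: v) ^+ 2 / 2) ?W; last by field.
  rewrite -W mulrA divfK ?divff ?pnatr_eq0//.
  by rewrite sqrf_eq0 rnorm_eq0.
by rewrite reflectionE k1 scale1r subKr.
Qed.

End Operators.

(** * Vector states *)

Section VectorStates.
Context {R : realType} {H : hilbertType R}.
Local Notation A := (bop H).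
Implicit Types (x y z : nat -> A) (e h u v w : H).

Definition vector_functional h (T : A) : R[i] := hdot (T h) h.

Lemma vector_functional_linear h : scalar (vector_functional h).
Proof. by move=> a S T; rewrite /vector_functional -hdotZl -hdotDl. Qed.

HB.instance Definition _ (h : H) := GRing.isLinear.Build R[i] A R[i] *%R
  (vector_functional h) (vector_functional_linear h).

Definition vector_state h : {scalar A} := vector_functional h.

Lemma vector_stateE h T : vector_state h T = hdot (T h) h.
Proof. by []. Qed.

Lemma vector_state_adjoint h S T :
  vector_state h (adjoint S * T) = hdot (T h) (S h).
Proof. exact: hdot_adjoint. Qed.

(** The square summable sequence that makes a vector functional one of the
    functionals generating the ultraweak topology. *)
Definition single h : nat -> H := fun n => if n is 0%N then h else 0.

Lemma square_summable_single h : square_summable (single h).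
Proof.
apply/cvg_ex; exists (rnorm h ^+ 2); apply: cvg_near_cst; exists 1%N => // n /= n1.
rewrite seriesEnat/= big_ltn// big_nat_cond big1 ?addr0// => -[|i]//= _.
by rewrite rnorm0 expr0n.
Qed.

Lemma uw_functional_single h T : uw_functional (single h, single h) T = hdot (T h) h.
Proof.
apply: (@cvg_lim R[i]^o); first exact: norm_hausdorff.
apply: cvg_near_cst; exists 1%N => // n /= n1.
rewrite seriesEnat/= big_ltn// big_nat_cond big1 ?addr0// => -[|i]//= _.
by rewrite bop0 linear0l.
Qed.

Lemma vector_state_normal h : rnorm h = 1 -> normal_state (vector_state h).
Proof.
move=> h1; split=> [T||T e e0].
- by rewrite vector_state_adjoint hdotuu ler0c exprn_ge0 ?rnorm_ge0.
- by rewrite vector_stateE hdotuu h1 expr1n.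
- exists [set (single h, single h)], e; split=> // [_ ->|S].
    by split; exact: square_summable_single.
  by move=> /(_ _ erefl); rewrite uw_functional_single -linearB.
Qed.

End VectorStates.

(** * The gliding hump *)

Section GlidingHump.
Context {R : realType} {H : hilbertType R}.
Local Notation A := (bop H).
Implicit Types (phi : {scalar A}) (x y z : nat -> A) (e h u v w : H).

Lemma seminorm_ge phi y x (s : R) n m : 0 <= s ->
  s ^+ 2 <= \sum_(n <= j < m) rnorm (phi (adjoint (y j) * x j)) ^+ 2 ->
  (s%:E <= seminorm phi y x)%E.
Proof.
move=> s0 sle; rewrite /seminorm.
have -> : s%:E = sqrte ((s ^+ 2)%:E) by rewrite /= sqrtr_sqr ger0_norm.
have F0 j : (0 <= (rnorm (phi (adjoint (y j) * x j)) ^+ 2)%:E)%E.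
  by rewrite lee_fin exprn_ge0 ?rnorm_ge0.
rewrite lee_sqrt ?nneseries_ge0//.
apply: (@le_trans _ _ (\sum_(0 <= j < maxn n m) (rnorm (phi (adjoint (y j) * x j)) ^+ 2)%:E)%E); last first.
  exact: nneseries_lim_ge.
rewrite sumEFin lee_fin; apply: (le_trans sle).
have [nm|mn] := leqP n m.
  rewrite (big_cat_nat (leq0n n) nm)/= lerDr; apply: sumr_ge0 => j _.
  by rewrite exprn_ge0 ?rnorm_ge0.
rewrite big_geq ?(ltnW mn)//; apply: sumr_ge0 => j _.
by rewrite exprn_ge0 ?rnorm_ge0.
Qed.

Lemma seminorm0 phi y : seminorm phi y (0 : nat -> A) = 0%E.
Proof.
rewrite /seminorm eseries0 ?sqrte0// => j _ _.
by rewrite mulr0 linear0 (rnorm0 R[i]) expr0n.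
Qed.

Lemma seminormN phi y x : seminorm phi y (- x) = seminorm phi y x.
Proof.
rewrite /seminorm; congr (sqrte _); apply: eq_eseriesr => j _.
by rewrite fctE mulrN linearN rnormN.
Qed.

Lemma norm_Re_le (a : R[i]) : `|complex.Re a| <= rnorm a.
Proof.
rewrite /rnorm normc_def/= -sqrtr_sqr ler_sqrt ?addr_ge0 ?sqr_ge0//.
by rewrite lerDl sqr_ge0.
Qed.

Lemma peaking_vector h u : rnorm h = 1 ->
  exists2 e, rnorm e = 1 & rdot u e = rnorm u.
Proof.
move=> h1; have [->|nz] := eqVneq u 0.
  (* A unit vector is chosen here too, so that the supremum in the definition of
     the seminorms is 1 whatever the sequences are. *)
  by exists h => //; rewrite rnorm0 /rdot linear0l.
have nz' : rnorm u != 0 by rewrite rnorm_eq0.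
exists (((rnorm u)^-1)%:C%C *: u).
  by rewrite rnormZ rnorm_real ger0_norm ?invr_ge0 ?rnorm_ge0// mulVf.
by rewrite rdotZr rdotuu expr2 mulKf.
Qed.

(** A weighted form of the triangle inequality for squares, which can be summed
    over a block term by term. *)
Lemma sqrB_ge (a b t : R) : 0 < t -> (1 - t) * a ^+ 2 - b ^+ 2 / t <= (a - b) ^+ 2.
Proof.
move=> t0; rewrite -subr_ge0.
have -> : (a - b) ^+ 2 - ((1 - t) * a ^+ 2 - b ^+ 2 / t) =
   (t * a - b) ^+ 2 / t + b ^+ 2 by field; rewrite gt_eqF.
by rewrite addr_ge0 ?sqr_ge0// divr_ge0 ?sqr_ge0// ltW.
Qed.

(** The seminorm consists of the vector state of [h] and of the rank one operators
    [y j] sending [h] to the direction of [X k j h], where [k] is the block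
    containing [j]. For [l < k] the terms of the [k]-th block alone separate [X k]
    from [X l]: there [X k] is measured at its full size, at least [c ^+ 2] in
    square, while [X l] is past its own block and measures at most [d]. The
    parameter [t] balances the two in [sqrB_ge]. *)
Lemma gliding_hump (X : nat -> nat -> A) (N : nat -> nat) h (c s d t : R) :
  rnorm h = 1 -> 0 < s -> 0 < t <= 1 ->
  s ^+ 2 <= (1 - t) * c ^+ 2 - d / t ->
  (forall k, (N k <= N k.+1)%N) ->
  (forall k, c ^+ 2 <= sqsum (X k) h (N k) (N k.+1)) ->
  (forall k m, sqsum (X k) h (N k.+1) m <= d) ->
  exists2 p, P_seminorms p &
    forall k l, k != l -> (s%:E <= p (X k - X l)%R)%E.
Proof.
move=> h1 s0 /andP[t0 t1] sle Nmono hump small.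
have Nhomo : {homo N : k l / (k <= l)%N}.
  by apply: homo_leq => // k l m; exact: leq_trans.
(* The blocks are disjoint, so each index [j] has at most one hump to follow. *)
have /choice[e eP] : forall j, exists e, rnorm e = 1 /\
    forall k, (N k <= j < N k.+1)%N -> rdot (X k j h) e = rnorm (X k j h).
  move=> j; have [[k kj]|no] := pselect (exists k, (N k <= j < N k.+1)%N).
    have [e e1 eP] := peaking_vector (X k j h) h1; exists e; split=> // k' k'j.
    suff -> : k' = k by [].
    have disj a b : (N a <= j < N a.+1)%N -> (N b <= j < N b.+1)%N -> (a <= b)%N.
      move=> /andP[aj _] /andP[_ jb]; rewrite leqNgt; apply/negP => /Nhomo ba.
      by have := leq_trans jb (leq_trans ba aj); rewrite ltnn.
    by apply/eqP; rewrite eqn_leq (disj _ _ k'j kj) (disj _ _ kj k'j).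
  by exists h; split=> // k kj; case: no; exists k.
pose y j := rank_one (e j) h.
have yh j : y j h = e j by rewrite rank_oneE hdotuu h1 expr1n scale1r.
exists (seminorm (vector_state h) y).
  exists (vector_state h), y; split=> //; first exact: vector_state_normal.
  rewrite (_ : [set _ | _ in _] = [set 1%E]) ?ereal_sup1//.
  have E j : complex.Re (vector_state h (adjoint (y j) * y j)) = 1.
    by rewrite vector_state_adjoint !yh hdotuu (eP j).1 expr1n.
  by apply/seteqP; split=> [_ [j _ <-]|_ ->]; [rewrite /= E|exists 0%N => //; rewrite E].
have late k l : (l < k)%N -> (s%:E <= seminorm (vector_state h) y (X k - X l)%R)%E.
  move=> lk; apply: (@seminorm_ge _ _ _ _ (N k) (N k.+1)); first exact: ltW.
  apply: (le_trans sle).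
  apply: (@le_trans _ _ (\sum_(N k <= j < N k.+1)
     ((1 - t) * rnorm (X k j h) ^+ 2 - rnorm (X l j h) ^+ 2 / t))).
    rewrite big_split/= -big_distrr/= sumrN -big_distrl/=; apply: lerB.
      by rewrite ler_wpM2l ?subr_ge0//; exact: hump.
    rewrite ler_wpM2r ?invr_ge0 ?(ltW t0)//; apply: le_trans (small l (N k.+1)).
    by rewrite [leRHS](sqsum_split _ _ (Nhomo _ _ lk) (Nmono k)) lerDr sqsum_ge0.
  apply: ler_sum_nat => j jk; rewrite vector_state_adjoint yh.
  have -> : (X k - X l) j h = X k j h - X l j h by [].
  set b := rnorm (X l j h).
  have := (eP j).2 k jk; set a := rnorm _ => aE.
  have bB : `|rdot (X l j h) (e j)| <= b.
    by apply: (le_trans (rdot_CauchySchwarz _ _)); rewrite (eP j).1 mulr1.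
  apply: (@le_trans _ _ ((a - rdot (X l j h) (e j)) ^+ 2)).
    apply: le_trans (sqrB_ge a _ t0); rewrite lerB// ler_wpM2r ?invr_ge0 ?(ltW t0)//.
    by rewrite -[leLHS]real_normK ?num_real// lerXn2r ?nnegrE ?rnorm_ge0.
  rewrite -aE -rdotBl -[leLHS]real_normK ?num_real//.
  by rewrite lerXn2r ?nnegrE ?rnorm_ge0// norm_Re_le.
move=> k l; rewrite neq_ltn => /orP[kl|lk]; last exact: late.
by rewrite -seminormN opprB; exact: late.
Qed.

End GlidingHump.

(** * The two bounds for lambda *)

Section Lambda.
Context {R : realType} {H : hilbertType R}.
Local Notation A := (bop H).
Implicit Types (E M : set (nat -> A)) (x y z : nat -> A) (h u : H).

Lemma sup_norm_ub E x : l2_bounded E -> E x -> l2_norm x <= sup_norm E.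
Proof.
move=> [_ [k kE]] Ex; apply: ub_le_sup; last by exists x.
by exists k => _ [y Ey <-]; exact: kE.
Qed.

Lemma dist_to_submodule_le M x : closed_submodule M -> dist_to M x <= l2_norm x.
Proof. by move=> [_ M0 _ _ _]; have := dist_to_le x M0; rewrite subr0. Qed.

Lemma lambda_le E M (eta : R) : free_fg_submodule M -> 0 < eta ->
  sup [set dist_to M x | x in E] < eta -> lambda E <= eta.
Proof.
move=> Mf eta0 Eeta; apply: ge_inf; last by split=> //; exists M.
by exists 0 => y [y0 _]; exact: ltW.
Qed.

(** Already the zero submodule gives this bound. *)
Lemma lambda_le_sup_norm E : l2_bounded E -> E !=set0 -> lambda E <= sup_norm E.
Proof.
move=> Eb [x0 Ex0]; apply/ler_addgt0Pl => e e0.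
have S0 : 0 <= sup_norm E := le_trans (l2_norm_ge0 x0) (sup_norm_ub Eb Ex0).
apply: (lambda_le (supported_below_free 0)); first by rewrite ltr_pwDl.
apply: (@le_lt_trans _ _ (sup_norm E)); last by rewrite ltrDr.
apply: ge_sup; first by exists (dist_to (@supported_below _ H 0) x0), x0.
move=> _ [x Ex <-]; apply: le_trans (sup_norm_ub Eb Ex).
exact: dist_to_submodule_le (supported_below_closed 0).
Qed.

Lemma lambda_set0 : lambda (set0 : set (nat -> A)) <= 0.
Proof.
apply/ler_addgt0Pl => e e0; rewrite addr0.
apply: (@lambda_le _ _ _ (supported_below_free 0)) => //.
by rewrite image_set0 sup0.
Qed.

(** If all the distances were at most [c], the midpoint of [c] and [lambda E] would
    already be admissible in the infimum that defines [lambda E]. *)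
Lemma lt_lambda_far E M (c : R) : l2_bounded E -> free_fg_submodule M ->
  0 < c < lambda E -> exists2 x, E x & c < dist_to M x.
Proof.
move=> Eb Mf /andP[c0 cl]; apply: contrapT => no.
have [E0|/set0P[x0 Ex0]] := eqVneq E set0.
  by have := lambda_set0; rewrite -E0 leNgt (lt_trans c0 cl).
suff /(lambda_le Mf) : sup [set dist_to M x | x in E] < (c + lambda E) / 2.
  have : 0 < (c + lambda E) / 2 by lra.
  by move=> l0 /(_ l0); lra.
apply: (@le_lt_trans _ _ c); last by lra.
apply: ge_sup; first by exists (dist_to M x0), x0.
by move=> _ [x Ex <-]; rewrite leNgt; apply/negP => cx; apply: no; exists x.
Qed.

Lemma sqsum_small_tail x u (d : R) m : l2 x -> 0 < d ->
  exists2 K, (m <= K)%N & forall n, sqsum x u K n <= d.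
Proof.
move=> lx d0; have /cvgrPdist_lt/(_ _ d0)[K0 _ hK] := @sqsum_cvg _ _ x u lx.
exists (maxn m K0); first exact: leq_maxl.
move=> n; have := hK _ (leq_maxr m K0); set K := maxn m K0 => KL.
have [Kn|nK] := leqP K n; last by rewrite /sqsum big_geq ?(ltnW nK)// ltW.
apply: le_trans (ltW KL); apply: le_trans (ler_norm _).
rewrite lerBrDl -(sqsum_split x u (leq0n K) Kn); exact: sqsum_le_lim.
Qed.

Lemma sqsum_act x (U : A) u n m : sqsum (l2_act x U) u n m = sqsum x (U u) n m.
Proof. by []. Qed.

(** One step of the construction. Some element of [E] has a large tail after [n],
    seen by a unit vector that depends on [n]; since [E] is balanced, a unitary
    moves that vector to the fixed vector [h]. The block is then extended until
    what remains of the sequence at [h] is below [d]. *)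
Lemma next_hump E h (c d : R) n : l2_bounded E -> balanced E -> rnorm h = 1 ->
  0 < c < lambda E -> 0 < d ->
  exists xm : (nat -> A) * nat, [/\ E xm.1, (n <= xm.2)%N,
    c ^+ 2 <= sqsum xm.1 h n xm.2 & forall m, sqsum xm.1 h xm.2 m <= d].
Proof.
move=> Eb Ebal h1 cl d0.
have [x Ex cx] := lt_lambda_far Eb (supported_below_free n) cl.
have [u [m [u1 cm]]] := far_from_supported_below (Eb.1 _ Ex) (andP cl).1 cx.
have [U [a [UU a1 Uh]]] := unitary_transitive h1 u1.
have ExU := Ebal _ _ Ex UU.
have [K mK small] := sqsum_small_tail h (maxn n m) (Eb.1 _ ExU) d0.
move: mK; rewrite geq_max => /andP[nK mK].
exists (l2_act x U, K); split=> //=.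
have [nm|mn] := leqP n m; last first.
  by move: cm; rewrite /sqsum big_geq ?(ltnW mn)// ltNge sqr_ge0.
rewrite (sqsum_split _ h nm mK) ler_wpDr ?sqsum_ge0//.
by rewrite sqsum_act Uh sqsum_phase// ltW.
Qed.

Lemma I_meas_ge E p (s : R) (X : nat -> nat -> A) : P_seminorms p -> 0 < s ->
  (forall k, E (X k)) -> (forall k l, k != l -> (s%:E <= p (X k - X l)%R)%E) ->
  (s%:E <= I_meas E p)%E.
Proof.
move=> [phi [y [_ _ pE]]] s0 EX sep.
have Xinj : injective X.
  move=> k l Xkl; apply/eqP; apply: contraT => /sep.
  by rewrite Xkl subrr pE seminorm0 lee_fin leNgt s0.
apply: ereal_sup_ubound; right; exists s => //; split=> //; exists (range X).
split=> [_ [k _ <-] //||_ _ [k _ <-] [l _ <-] Xkl].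
  move=> fX; apply: infinite_nat.
  have := @finite_preimage _ _ (range X) X (in2W Xinj) fX.
  by rewrite preimage_range.
by apply: sep; apply/eqP => kl; apply: Xkl; rewrite kl.
Qed.

(** The blocks are obtained by iterating [next_hump], each starting where the
    previous one ends. *)
Lemma lambda_le_Istar E : l2_bounded E -> balanced E -> ((lambda E)%:E <= Istar E)%E.
Proof.
move=> Eb Ebal; apply/lee_subgt0Pr => e e0; rewrite -EFinB.
have [s0|s0] := leP (lambda E - e) 0.
  by apply: (@le_trans _ _ 0%E); [rewrite lee_fin|apply: ereal_sup_ubound; left].
set s := lambda E - e in s0 *; pose c := lambda E - e / 2.
have sc : s < c by rewrite /s /c; lra.
have c0 : 0 < c := lt_trans s0 sc.
have cl : 0 < c < lambda E by rewrite c0 /c; lra.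
(* Half of the gap [g] is lost to the factor [1 - t], and the other half to the
   interference [d / t] of the earlier sequences. *)
pose g := c ^+ 2 - s ^+ 2; pose t := g / (2 * c ^+ 2); pose d := t * (g / 2).
have cc : 0 < c ^+ 2 by rewrite exprn_gt0.
have g0 : 0 < g by rewrite subr_gt0 ltr_sqr ?nnegrE ?ltW.
have t0 : 0 < t by rewrite divr_gt0// mulr_gt0.
have t1 : t <= 1.
  rewrite ler_pdivrMr ?mulr_gt0// mul1r /g.
  by have := sqr_ge0 s; lra.
have d0 : 0 < d by rewrite mulr_gt0// divr_gt0.
have sE : s ^+ 2 <= (1 - t) * c ^+ 2 - d / t.
  rewrite /d (mulrC t) mulfK ?gt_eqF// mulrBl mul1r.
  have -> : t * c ^+ 2 = g / 2 by rewrite /t; field; rewrite gt_eqF.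
  by rewrite /g; lra.
have [x0 Ex0 cx0] := lt_lambda_far Eb (supported_below_free 0) cl.
have [h [_ [h1 _]]] := far_from_supported_below (Eb.1 _ Ex0) c0 cx0.
have /choice[f fP] := fun n => next_hump n Eb Ebal h1 cl d0.
pose N k := iter k (fun n => (f n).2) 0%N.
have [p pP sep] : exists2 p, P_seminorms p &
    forall k l, k != l -> (s%:E <= p ((f (N k)).1 - (f (N l)).1)%R)%E.
  apply: (gliding_hump (N := N) h1 s0 _ sE) => [|k|k|k m]; first by rewrite t0.
  - by case: (fP (N k)).
  - by case: (fP (N k)).
  - by case: (fP (N k)).
apply: (@le_trans _ _ (I_meas E p)).
  by apply: (I_meas_ge pP s0 _ sep) => k; case: (fP (N k)).
by apply: ereal_sup_ubound; right; exists p.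
Qed.

End Lambda.

Theorem theorem4p4 (R : realType) (H : hilbertType R) (E : set (nat -> bop H)) :
  l2_bounded E -> balanced E ->
  ((lambda E)%:E <= sqrte ((sup_norm E)%:E * Istar E))%E.
Proof.
move=> Eb Ebal; have [l0|l0] := leP (lambda E) 0.
  by apply: le_trans (sqrte_ge0 _); rewrite lee_fin.
have [E0|/set0P E0] := eqVneq E set0.
  by move: l0; rewrite E0 ltNge lambda_set0.
have ls := lambda_le_sup_norm Eb E0; have lI := lambda_le_Istar Eb Ebal.
have -> : (lambda E)%:E = sqrte ((lambda E)%:E * (lambda E)%:E).
  by rewrite -EFinM /= -expr2 sqrtr_sqr gtr0_norm.
have le0 : (0 <= (lambda E)%:E)%E by rewrite lee_fin ltW.
rewrite lee_sqrt; first by apply: lee_pmul; rewrite ?lee_fin.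
by apply: mule_ge0; [apply: le_trans le0 _; rewrite lee_fin|exact: le_trans lI].
Qed.
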